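(* Let $M\in\{2,3,4,6\}$, $G=U(1)\leftthreetimes_\phi[\mathbb{Z}^2\rtimes\mathbb{Z}_M]$, and let $\mathcal{C}_G^\times$ be a $G$-crossed braided tensor category extending a unitary modular tensor category $\mathcal{C}_{\mathbf 0}$, such that $G$ does not permute the anyons. Assume the symmetry fractionalization has trivial vison and trivial anyon per unit cell, so that for some $s,t_x,t_y\in\mathcal{A}$ the Abelian defects $0_{\mathbf g}$ can be chosen with $0_{\mathbf g_1}\times0_{\mathbf g_2}=\mathfrak{w}(\mathbf g_1,\mathbf g_2)\times0_{\mathbf g_1\mathbf g_2}$ where, for $\mathbf g_i=(e^{2\pi i z_i},\mathbf r_i,e^{2\pi i h_i/M})$ with $0\le h_i<M$, $$\mathfrak{w}(\mathbf g_1,\mathbf g_2)=s^{\frac{h_1+h_2-[h_1+h_2]_M}{M}}\times\vec t\cdot\big((1-h)^{-1}(1-h^{h_1})\mathbf r_2\big).$$ Let $\mathbf r,\mathbf r'\in\mathbb{Z}^2$ and consider the defects $d_1=0_{(1,\mathbf 0,e^{2\pi i/M})}$, $d_2=0_{(1,\mathbf r',e^{2\pi i/M})}$, $d_3=0_{(1,\mathbf r,e^{2\pi i/M})}$, $d_4=0_{(1,\mathbf r+\mathbf r',e^{2\pi i/M})}$, where the four group elements have $M$-th power equal to the identity. Then $d_1^M=s$, $d_2^M=s\times\vec t\cdot(M(1-h)^{-1}\mathbf r')$, $d_3^M=s\times\vec t\cdot(M(1-h)^{-1}\mathbf r)$, $d_4^M=s\times\vec t\cdot(M(1-h)^{-1}(\mathbf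 r+\mathbf r'))$, and $$\left(\frac{\mathcal{I}_M(d_4)\,\mathcal{I}_M(d_1)}{\mathcal{I}_M(d_2)\,\mathcal{I}_M(d_3)}\right)^M=M_{\,\vec t\cdot(M(1-h)^{-1}\mathbf r),\ \vec t\cdot(M(1-h)^{-1}\mathbf r')}\,.$$
   Context: $h$ is the integer $2\times2$ matrix of order $M$ (in a lattice basis) generating rotations by $2\pi/M$; $(1-h)^{-1}(1-h^j)=1+h+\dots+h^{j-1}$ and $M(1-h)^{-1}$ are integer matrices. For $\mathbf u=(u_x,u_y)\in\mathbb{Z}^2$, $\vec t\cdot\mathbf u=t_x^{u_x}\times t_y^{u_y}\in\mathcal{A}$. $[k]_M$ is the residue of $k$ mod $M$ in $\{0,\dots,M-1\}$. The group $G$ consists of triples $(e^{2\pi i z},\mathbf r,e^{2\pi i j/M})$, $\mathbf r\in\mathbb{Z}^2$, with product $(e^{2\pi i(z_1+z_2+\frac{\phi}{2}\mathbf r_1\times h^{j_1}\mathbf r_2)},\mathbf r_1+h^{j_1}\mathbf r_2,e^{2\pi i(j_1+j_2)/M})$, $\mathbf r_1\times\mathbf r_2=x_1y_2-y_1x_2$, $\phi$ rational. $\mathcal{C}_{\mathbf 0}$ is a unitary modular tensor category (simple objects: ''anyons''); $\mathcal{A}$ is the finite Abelian group of Abelian (quantum dimension 1) anyons; $M_{a,b}=R^{a,b}R^{b,a}$ for $a,b\in\mathcal{A}$ (the double braid, not to be confused with the integer $M$); $\theta_a$ is the topological twist ($\theta_a=R^{a,a}$ for Abelian anyons and Abelian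 defects). For an Abelian $\mathbf g$-defect $d$ with $\mathbf g^M$ the identity, $\mathcal{I}_M(d)=\theta_d^M\prod_{j=0}^{M-1}\eta_d(\mathbf g,\mathbf g^j)$. A $G$-crossed braided tensor category (BTC) $\mathcal{C}_G^\times=\bigoplus_{\mathbf g\in G}\mathcal{C}_{\mathbf g}$ is a $G$-graded unitary fusion-type category with trivial component $\mathcal{C}_{\mathbf 0}$ ($\mathbf 0$ the identity of $G$), a $G$-action $x\mapsto{}^{\mathbf k}x$ mapping $\mathcal{C}_{\mathbf g}\to\mathcal{C}_{\mathbf{kgk}^{-1}}$, and a $G$-crossed braiding ($c_{\mathbf k}\times a_{\mathbf g}={}^{\mathbf k}a_{\mathbf g}\times c_{\mathbf k}$). Simple objects of $\mathcal{C}_{\mathbf g}$ are $\mathbf g$-defects; a defect is Abelian if it has quantum dimension 1. Skeletally it is given by data $\{F,R,U,\eta\}$: $F$-symbols satisfying the pentagon equation; $G$-crossed $R$-symbols; phases/matrices $U_{\mathbf k}(a,b;c)$ for the action of $\mathbf k$ on splitting spaces; phases $\eta_x(\mathbf g,\mathbf h)$ relating the action of $\mathbf{gh}$ to the composition of the actions, with $U_{\mathbf 0}=1$, $\eta_0=1$, $\eta_x(\mathbf g,\mathbf 0)=\eta_x(\mathbf 0,\mathbf h)=1$. For Abelian objects subscripts are dropped, and for $a\in\mathcal{C}_{\mathbf g},b\in\mathcal{C}_{\mathbf h},c\in\mathcal{C}_{\mathbf k}$, with $\bar{\mathbf g}=\mathbf g^{-1}$, the consistency equations read $R^{a,c}F^{a,c,{}^{\bar{\mathbf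 k}}b}R^{b,c}=F^{c,{}^{\bar{\mathbf k}}a,{}^{\bar{\mathbf k}}b}\,U_{\mathbf k}(a,b)\,R^{ab,c}F^{a,b,c}$, $(R^{c,a})^{-1}F^{a,{}^{\bar{\mathbf g}}c,b}(R^{{}^{\bar{\mathbf g}}c,b})^{-1}=F^{c,a,b}\,\eta_c(\mathbf g,\mathbf h)\,(R^{c,ab})^{-1}F^{a,b,{}^{\bar{\mathbf h}\bar{\mathbf g}}c}$, $\eta_x(\mathbf g,\mathbf h)\eta_x(\mathbf{gh},\mathbf k)=\eta_{{}^{\bar{\mathbf g}}x}(\mathbf h,\mathbf k)\eta_x(\mathbf g,\mathbf{hk})$, $\eta_a(\mathbf k,\mathbf l)\eta_b(\mathbf k,\mathbf l)U_{\mathbf l}({}^{\bar{\mathbf k}}a,{}^{\bar{\mathbf k}}b)U_{\mathbf k}(a,b)=U_{\mathbf{kl}}(a,b)\eta_{ab}(\mathbf k,\mathbf l)$, and the $G$-crossed ribbon property $R^{b,{}^{\bar{\mathbf h}}a}R^{a,b}=\frac{\theta_{ab}}{\theta_a\theta_b}\frac{U_{\mathbf{gh}}(a,b)}{\eta_a(\mathbf g,\mathbf h)\eta_b(\mathbf h,\bar{\mathbf h}\mathbf{gh})}$. *)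

(* Defs.v *)
From HB Require Import structures.
From mathcomp Require Import all_boot all_order all_algebra.
From mathcomp Require Import complex ring.
From mathcomp Require Import reals topology normedtype trigo.
Import Order.TTheory GRing.Theory Num.Theory.

Set Implicit Arguments.
Unset Strict Implicit.
Unset Printing Implicit Defensive.

Local Open Scope ring_scope.
Local Open Scope complex_scope.

Section Circle.
Variable R : realType.

(* cis x = e^{ix} *)
Definition cis (x : R) : R[i] := cos x +i* sin x.

Lemma cisD x y : cis (x + y) = cis x * cis y.
Proof. by rewrite /cis cosD sinD; simpc; congr (_ +i* _); rewrite addrC. Qed.

Lemma cis0 : cis 0 = 1.
Proof. by rewrite /cis cos0 sin0. Qed.

Lemma norm_cis x : `|cis x| = 1.
Proof. by rewrite normc_def cos2Dsin2 sqrtr1. Qed.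

Record circle := Circle { cval :> R[i]; cvalP : `|cval| == 1 }.
HB.instance Definition _ := [isSub for cval].
HB.instance Definition _ := [Choice of circle by <:].

Lemma circle_mulP (u v : circle) : `|cval u * cval v| == 1.
Proof. by rewrite normrM (eqP (cvalP u)) (eqP (cvalP v)) mulr1. Qed.
Lemma circle_invP (u : circle) : `|(cval u)^-1| == 1.
Proof. by rewrite normfV (eqP (cvalP u)) invr1. Qed.
Lemma circle_cisP x : `|cis x| == 1.
Proof. by rewrite norm_cis. Qed.
Lemma circle_1P : `|1 : R[i]| == 1.
Proof. by rewrite normr1. Qed.

Definition circle1 := Circle circle_1P.
Definition circle_mul u v := Circle (circle_mulP u v).
Definition circle_inv u := Circle (circle_invP u).
Definition circle_cis x := Circle (circle_cisP x).

End Circle.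

Section LatticeRotation.
Variable R : realType.

(* The matrix of the plane rotation by the angle t, acting on columns. *)
Definition rot2 (t : R) : 'M[R]_2 :=
  \matrix_(i, j) if i == j then cos t else if i == 0 then - sin t else sin t.

(* [rmx] is the matrix, in the basis formed by the columns of B, of the       *)
(* rotation of the plane by 2 pi / M.                                         *)
Record lattice_rotation (M : nat) := LatticeRotation {
  rmx :> 'M[int]_2;
  rmxP : exists2 B : 'M[R]_2, B \in unitmx &
    B *m map_mx intr rmx = rot2 (2 * pi / M%:R) *m B
}.

Lemma rot2D s t : rot2 (s + t) = rot2 s *m rot2 t.
Proof.
apply/matrixP => i j; rewrite !mxE !big_ord_recl big_ord0 /= !mxE cosD sinD.
case: i => [[|[|//]] ?]; case: j => [[|[|//]] ?] /=; rewrite addr0.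
- by rewrite mulNr.
- by rewrite mulrN mulNr opprD addrC.
- by [].
by rewrite mulrN addrC.
Qed.

Lemma rot2_0 : rot2 0 = 1%:M.
Proof.
apply/matrixP => i j; rewrite !mxE cos0 sin0 oppr0.
by case: (i == j) => //=; rewrite if_same.
Qed.

Lemma rot2_exp t n : rot2 t ^+ n = rot2 (t *+ n).
Proof.
elim: n => [|n IHn]; first by rewrite expr0 mulr0n rot2_0.
by rewrite exprS IHn mulrS rot2D.
Qed.

Lemma det_rot2 t : \det (rot2 t) = 1.
Proof.
rewrite (expand_det_row _ 0) !big_ord_recl big_ord0 /cofactor !det_mx11 !mxE /=.
by rewrite -[RHS](cos2Dsin2 t) addr0 expr0 expr1; ring.
Qed.

Lemma det_lattice_rotation M (h : lattice_rotation M) : \det h = 1.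
Proof.
have [B Bu /(congr1 determinant)] := rmxP h.
rewrite !det_mulmx det_rot2 mul1r -[RHS]mulr1.
move: Bu; rewrite unitmxE => /mulrI Binj /Binj; rewrite det_map_mx => dh.
by apply: (@intr_inj R); rewrite dh.
Qed.

Lemma lattice_rotation_exp M (h : lattice_rotation M) n :
  rot2 (2 * pi / M%:R *+ n) = 1%:M -> rmx h ^+ n = 1.
Proof.
move=> rn; have [B Bu Bh] := rmxP h.
have {}Bh : B *m map_mx intr (rmx h ^+ n) = B.
  suff -> : B *m map_mx intr (rmx h ^+ n) = rot2 (2 * pi / M%:R) ^+ n *m B.
    by rewrite rot2_exp rn mul1mx.
  elim: n {rn} => [|n IHn]; first by rewrite !expr0 map_mx1 mulmx1 mul1mx.
  by rewrite !exprS map_mxM mulmxA Bh -mulmxA IHn mulmxA.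
have {}Bh : map_mx (intr : int -> R) (rmx h ^+ n) = 1%:M.
  by rewrite -[LHS](mulKmx Bu) Bh mulVmx.
apply/matrixP => i j; move/matrixP/(_ i j): Bh; rewrite !mxE => hij.
by apply: (@intr_inj R); rewrite hij; case: (i == j).
Qed.

Lemma lattice_rotation_order M (h : lattice_rotation M) :
  rmx h ^+ (Zp_trunc M).+2 = 1.
Proof.
apply: lattice_rotation_exp; case: M {h} => [|[|M]] /=.
- by rewrite invr0 mulr0 mul0rn rot2_0.
- rewrite divr1 mulr2n rot2D.
  suff -> : rot2 (2 * pi) = 1%:M by rewrite mul1mx.
  by apply/matrixP => i j; rewrite !mxE mulr_natl cos2pi sin2pi oppr0;
     case: (i == j) => //=; rewrite if_same.
rewrite /Zp_trunc /= -mulr_natr mulfVK ?pnatr_eq0//.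
by apply/matrixP => i j; rewrite !mxE mulr_natl cos2pi sin2pi oppr0;
   case: (i == j) => //=; rewrite if_same.
Qed.

Lemma subr_rot2_det t : \det (1%:M - rot2 t) = (1 - cos t) *+ 2.
Proof.
rewrite (expand_det_row _ 0) !big_ord_recl big_ord0 /cofactor !det_mx11 !mxE /=.
have s2 : sin t ^+ 2 = 1 - cos t ^+ 2 by rewrite -(cos2Dsin2 t); ring.
rewrite addr0 expr0 expr1 !mulr1n !mulr0n.
transitivity ((1 - cos t) ^+ 2 + sin t ^+ 2); first by ring.
by rewrite s2; ring.
Qed.

End LatticeRotation.

Definition cross (r1 r2 : 'cV[int]_2) : int :=
  r1 0 0 * r2 1 0 - r1 1 0 * r2 0 0.

(* The group U(1) x_phi [Z^2 : Z_M]. The triple                               *)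
(* (e^{2 pi i z}, r, e^{2 pi i j / M}) is [SymElt h phi u r j] with           *)
(* u = e^{2 pi i z}. As 1 < M in the cases of interest, 'Z_M is Z/M, and the  *)
(* underlying natural number of j : 'Z_M is its representative in [0, M[.     *)
(* The parameters h and phi only enter through the group law.                 *)
Record sym_group (R : realType) (M : nat) (h : lattice_rotation R M)
    (phi : rat) := SymElt {
  phase : circle R;
  trans : 'cV[int]_2;
  angle : 'Z_M
}.
Arguments SymElt {R M} h phi phase trans angle.

Section SymmetryGroup.
Variables (R : realType) (M : nat) (h : lattice_rotation R M) (phi : rat).
Local Notation sym_group := (sym_group h phi).
Local Notation SymElt := (SymElt h phi).

Definition sym_one : sym_group := SymElt (circle1 R) 0 0.

(* 2 pi * (phi / 2) * (r1 x h^j1 r2) is the angle of the extra phase.         *)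
Definition sym_mul (g1 g2 : sym_group) : sym_group :=
  let r2 := rmx h ^+ angle g1 *m trans g2 in
  SymElt
    (circle_mul (circle_mul (phase g1) (phase g2))
       (circle_cis (2 * pi * (ratr phi / 2 * (cross (trans g1) r2)%:~R))))
    (trans g1 + r2)
    (angle g1 + angle g2).

Definition sym_inv (g : sym_group) : sym_group :=
  SymElt (circle_inv (phase g)) (- (rmx h ^+ (- angle g)%R *m trans g))
    (- angle g).

Definition sym_tuple (g : sym_group) := (phase g, trans g, angle g).
Definition tuple_sym (p : circle R * 'cV[int]_2 * 'Z_M) :=
  SymElt p.1.1 p.1.2 p.2.
Lemma sym_tupleK : cancel sym_tuple tuple_sym. Proof. by case. Qed.

HB.instance Definition _ := Choice.copy sym_group (can_type sym_tupleK).

Lemma circle_inj (u v : circle R) : cval u = cval v -> u = v.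
Proof. exact: val_inj. Qed.

Lemma rmx_expD (j1 j2 : 'Z_M) :
  rmx h ^+ (j1 + j2)%R = rmx h ^+ j1 *m rmx h ^+ j2.
Proof.
rewrite -[RHS]exprD /= [in RHS](divn_eq (j1 + j2) (Zp_trunc M).+2).
by rewrite exprD mulnC exprM lattice_rotation_order expr1n mul1r.
Qed.

Lemma cross_mull (A : 'M[int]_2) r1 r2 :
  cross (A *m r1) (A *m r2) = \det A * cross r1 r2.
Proof.
rewrite (expand_det_row _ 0) !big_ord_recl big_ord0 /cofactor !det_mx11 !mxE.
rewrite /cross !mxE !big_ord_recl !big_ord0 /=.
set x := lift 0 0; have -> : x = 1 by apply: val_inj.
have -> : lift 1 0 = 0 :> 'I_2 by apply: val_inj.
by rewrite expr0 expr1; ring.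
Qed.

Lemma sym_mulA : associative sym_mul.
Proof.
move=> [u1 r1 j1] [u2 r2 j2] [u3 r3 j3]; rewrite /sym_mul /=; congr (SymElt _ _ _).
- apply: circle_inj => /=.
  have -> : cross r1 (rmx h ^+ j1 *m (r2 + rmx h ^+ j2 *m r3)) =
            cross r1 (rmx h ^+ j1 *m r2) + cross r1 (rmx h ^+ (j1 + j2)%R *m r3).
    by rewrite rmx_expD mulmxDr mulmxA /cross !mxE; ring.
  have -> : cross (r1 + rmx h ^+ j1 *m r2) (rmx h ^+ (j1 + j2)%R *m r3) =
            cross r1 (rmx h ^+ (j1 + j2)%R *m r3) + cross r2 (rmx h ^+ j2 *m r3).
    have -> : cross r2 (rmx h ^+ j2 *m r3) =
              cross (rmx h ^+ j1 *m r2) (rmx h ^+ (j1 + j2)%R *m r3).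
      rewrite rmx_expD -mulmxA cross_mull.
      have -> : \det (rmx h ^+ j1) = 1; last by rewrite mul1r.
      elim: (j1 : nat) => [|n IHn]; first by rewrite expr0 det1.
      by rewrite exprS det_mulmx det_lattice_rotation IHn mulr1.
    by rewrite /cross; set v := _ *m r3; set w := _ *m r2; rewrite !mxE; ring.
  by rewrite !rmorphD /= !mulrDr !cisD; ring.
- by rewrite rmx_expD mulmxDr !mulmxA addrA.
by rewrite addrA.
Qed.

Lemma sym_mul1g : left_id sym_one sym_mul.
Proof.
move=> [u r j]; rewrite /sym_mul /= expr0 mul1mx !add0r; congr (SymElt _ _ _).
apply: circle_inj => /=; have -> : cross 0 r = 0 by rewrite /cross !mxE; ring.
by rewrite !mulr0 cis0 mul1r mulr1.
Qed.

Lemma sym_mulg1 : right_id sym_one sym_mul.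
Proof.
move=> [u r j]; rewrite /sym_mul /= mulmx0 !addr0; congr (SymElt _ _ _).
apply: circle_inj => /=; have -> : cross r 0 = 0 by rewrite /cross !mxE; ring.
by rewrite !mulr0 cis0 !mulr1.
Qed.

Lemma sym_mulgV : right_inverse sym_one sym_inv sym_mul.
Proof.
move=> [u r j]; rewrite /sym_mul /sym_inv.
have hr : rmx h ^+ j *m - (rmx h ^+ (- j)%R *m r) = - r.
  by rewrite mulmxN mulmxA -rmx_expD addrN expr0 mul1mx.
cbn [phase trans angle]; rewrite hr !addrN; congr (SymElt _ _ _); apply: circle_inj => /=.
have -> : cross r (- r) = 0 by rewrite /cross !mxE; ring.
by rewrite !mulr0 cis0 mulr1 mulfV// -normr_eq0 (eqP (cvalP u)) oner_eq0.
Qed.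

Lemma sym_mulVg : left_inverse sym_one sym_inv sym_mul.
Proof.
move=> [u r j]; rewrite /sym_mul /sym_inv; cbn [phase trans angle].
rewrite !addNr; congr (SymElt _ _ _); apply: circle_inj => /=; set v := _ *m r.
have -> : cross (- v) v = 0 by rewrite /cross !mxE; ring.
by rewrite !mulr0 cis0 mulr1 mulVf// -normr_eq0 (eqP (cvalP u)) oner_eq0.
Qed.

HB.instance Definition _ := isGroup.Build sym_group
  sym_mulA sym_mul1g sym_mulg1 sym_mulVg sym_mulgV.

End SymmetryGroup.

Section IntegerMatrices.
Variables (R : realType) (M : nat) (h : lattice_rotation R M).

Definition rmxQ : 'M[rat]_2 := map_mx intr (rmx h).

(* (1 - h)^-1 (1 - h^j) and M (1 - h)^-1, computed over the rationals; both   *)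
(* have integer entries (see below), which numq reads off.                    *)
Definition geom_mx (j : nat) : 'M[int]_2 :=
  map_mx numq (invmx (1 - rmxQ) *m (1 - rmxQ ^+ j)).
Definition Minv_mx : 'M[int]_2 := map_mx numq (M%:R *: invmx (1 - rmxQ)).

Hypothesis M_gt1 : (1 < M)%N.

Lemma unitmx_1subr : 1 - rmxQ \in unitmx.
Proof.
have [B Bu Bh] := rmxP h.
have dB : (\det (1 - rmx h))%:~R = (1 - cos (2 * pi / M%:R)) *+ 2 :> R.
  rewrite -det_map_mx map_mxB map_mx1 -subr_rot2_det; move: (Bu); rewrite unitmxE => /mulIr; apply.
  by rewrite [LHS]mulrC -!det_mulmx mulmxBr mulmxBl mulmx1 mul1mx Bh.
rewrite unitmxE unitfE; apply/negP => /eqP d0.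
have d0' : \det (1 - rmx h) = 0.
  by apply: (@intr_inj rat); rewrite -det_map_mx map_mxB map_mx1.
move: dB; rewrite d0' => /esym/eqP.
rewrite mulrn_eq0 /= subr_eq0 => /eqP c1.
have M0 : 0 < M%:R :> R by rewrite ltr0n ltnW.
have a0 : 0 < 2 * pi / M%:R :> R by rewrite divr_gt0// mulr_gt0// pi_gt0.
have api : 2 * pi / M%:R <= pi :> R.
  by rewrite ler_pdivrMr// mulrC ler_pM2l ?pi_gt0// ler_nat.
have := @cos_inj R 0 (2 * pi / M%:R).
rewrite !in_itv /= lexx pi_ge0 (ltW a0) api cos0 => /(_ isT isT c1) a0'.
by move: a0; rewrite -a0' ltxx.
Qed.

Lemma geom_mxE j : geom_mx j = \sum_(i < j) rmx h ^+ i.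
Proof.
rewrite /geom_mx.
have -> : 1 - rmxQ ^+ j = (1 - rmxQ) *m \sum_(i < j) rmxQ ^+ i.
  by rewrite -[LHS]opprB subrX1 -mulNr opprB.
rewrite mulKmx ?unitmx_1subr//.
have -> : \sum_(i < j) rmxQ ^+ i = map_mx intr (\sum_(i < j) rmx h ^+ i).
  by rewrite raddf_sum /=; apply: eq_bigr => i _; rewrite rmorphXn.
by apply/matrixP => i k; rewrite !mxE numq_int.
Qed.

Lemma Minv_mxE : (1 - rmx h) *m Minv_mx = M%:R.
Proof.
have hM : rmxQ ^+ M = 1.
  rewrite /rmxQ -rmorphXn /= -[X in _ ^+ X]Zp_cast// lattice_rotation_order.
  exact: map_mx1.
have hs : \sum_(j < M) rmxQ ^+ j = 0.
  have : (1 - rmxQ) *m \sum_(i < M) rmxQ ^+ i = 0.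
    by rewrite -[LHS]opprK -mulNr opprB -subrX1 hM subrr oppr0.
  by move=> /(congr1 (mulmx (invmx (1 - rmxQ)))); rewrite mulKmx ?unitmx_1subr// mulmx0.
have E : map_mx intr (\sum_(j < M) geom_mx j) = M%:R *: invmx (1 - rmxQ).
  have -> : M%:R *: invmx (1 - rmxQ) = invmx (1 - rmxQ) *m \sum_(j < M) (1 - rmxQ ^+ j).
    rewrite sumrB hs subr0 sumr_const card_ord -scaler_nat -scalemxAr.
    by rewrite mulmx1.
  rewrite mulmx_sumr raddf_sum; apply: eq_bigr => j _ /=.
  rewrite geom_mxE.
  have -> : 1 - rmxQ ^+ j = (1 - rmxQ) *m \sum_(i < j) rmxQ ^+ i.
    by rewrite -[LHS]opprB subrX1 -mulNr opprB.
  rewrite mulKmx ?unitmx_1subr// raddf_sum /=.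
  by apply: eq_bigr => i _; rewrite rmorphXn.
have -> : Minv_mx = \sum_(j < M) geom_mx j.
  by rewrite /Minv_mx -E; apply/matrixP => i j; rewrite !mxE numq_int.
have inj : injective (map_mx (intr : int -> rat) : 'M_2 -> 'M_2).
  move=> A B /matrixP AB; apply/matrixP => i j.
  by have := AB i j; rewrite !mxE => /intr_inj.
apply: inj; rewrite map_mxM E map_mxB map_mx1 -scalemxAr mulmxV ?unitmx_1subr//.
by rewrite rmorph_nat -scaler_nat.
Qed.

End IntegerMatrices.

Section GCrossed.
Variables (R : realType) (G : groupType).

(* Skeletal data. The labels (isomorphism classes of simple objects) form one *)
(* type graded by G; [sector g] lists the finitely many g-defects.            *)
(* Vertex labels of the splitting space V^{ab}_c are the naturals             *)
(* mu < fusN a b c; the values of F, R, U at other labels are irrelevant.     *)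
(*   Fsym a b c d e al be f mu nu = [F^{abc}_d]_{(e,al,be),(f,mu,nu)} with    *)
(*     al in V^{ab}_e, be in V^{ec}_d, mu in V^{bc}_f, nu in V^{af}_d;        *)
(*   Rsym a b c mu nu = [R^{ab}_c]_{mu,nu}, for b an h-defect, with           *)
(*     mu in V^{b,h^-1 a}_c and nu in V^{ab}_c;                               *)
(*   Usym k a b c mu nu = [U_k(a,b;c)]_{mu,nu}, with                          *)
(*     mu in V^{k^-1 a,k^-1 b}_{k^-1 c} and nu in V^{ab}_c;                   *)
(*   eta a g h = eta_a(g,h).                                                  *)
Record gcrossed_data := GCrossedData {
  label :> eqType;
  grade : label -> G;
  sector : G -> seq label;
  vacuum : label;
  dual_obj : label -> label;
  fusN : label -> label -> label -> nat;
  gact : G -> label -> label;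
  Fsym : label -> label -> label -> label ->
         label -> nat -> nat -> label -> nat -> nat -> R[i];
  Rsym : label -> label -> label -> nat -> nat -> R[i];
  Usym : G -> label -> label -> label -> nat -> nat -> R[i];
  eta : label -> G -> G -> R[i]
}.

Variable C : gcrossed_data.
Implicit Types (a b c d e f : C) (g h k l : G).
Local Notation gr := (@grade C).
Local Notation vac := (vacuum C).
Local Notation dual := (@dual_obj C).
Local Notation fus := (@fusN C).
Local Notation act := (@gact C).
Local Notation F := (@Fsym C).
Local Notation Rs := (@Rsym C).
Local Notation U := (@Usym C).
Local Notation "^! k" := (act (k^-1)%g) (at level 0, k at level 0).
Local Notation "a ** b" := (sector C (gr a * gr b)%g) (at level 40).

(* d_a = 1 / |[F^{a,dual a,a}_a]_{0,0}| *)
Definition qdim a : R[i] := `|F a (dual a) a a vac 0 0 vac 0 0|^-1.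

(* theta_a = sum_{c,mu} (d_c / d_a) [R^{aa}_c]_{mu,mu} *)
Definition twist a : R[i] :=
  \sum_(c <- a ** a) \sum_(mu < fus a a c) qdim c / qdim a * Rs a a c mu mu.

(* The inverse of the unitary matrix R^{ab}_c. *)
Definition Rinv a b c (mu nu : nat) : R[i] := (Rs a b c nu mu)^*.

Definition fusion_axioms : Prop :=
  [/\ (forall g, uniq (sector C g)),
      (forall g a, (a \in sector C g) = (gr a == g)),
      (forall g, exists a, gr a = g),
      (forall a b c, fus a b c != 0%N -> gr c = (gr a * gr b)%g)
    & (forall a b c d, (\sum_(e <- a ** b) fus a b e * fus e c d =
                        \sum_(f <- b ** c) fus b c f * fus a f d)%N)] /\
  [/\ gr vac = 1%g,
      (forall a b, fus vac a b = (a == b)),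
      (forall a b, fus a vac b = (a == b)),
      (forall a b, fus a b vac = (b == dual a))
    & (forall a, dual (dual a) = a)].

Definition action_axioms : Prop :=
  [/\ (forall a, act 1%g a = a),
      (forall k l a, act (k * l)%g a = act k (act l a))
    & (forall k a, gr (act k a) = (k * gr a * k^-1)%g)] /\
  [/\ (forall k, act k vac = vac),
      (forall k a b c, fus (act k a) (act k b) (act k c) = fus a b c)
    & (forall a b c, fus b (^!(gr b) a) c = fus a b c)].

Definition F_unitary : Prop := forall a b c d,
  (forall e al be e' al' be',
    (al < fus a b e)%N -> (be < fus e c d)%N ->
    (al' < fus a b e')%N -> (be' < fus e' c d)%N ->
    \sum_(f <- b ** c) \sum_(mu < fus b c f) \sum_(nu < fus a f d)
      F a b c d e al be f mu nu * (F a b c d e' al' be' f mu nu)^*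
    = ((e, al, be) == (e', al', be'))%:R) /\
  (forall f mu nu f' mu' nu',
    (mu < fus b c f)%N -> (nu < fus a f d)%N ->
    (mu' < fus b c f')%N -> (nu' < fus a f' d)%N ->
    \sum_(e <- a ** b) \sum_(al < fus a b e) \sum_(be < fus e c d)
      (F a b c d e al be f mu nu)^* * F a b c d e al be f' mu' nu'
    = ((f, mu, nu) == (f', mu', nu'))%:R).

(* F is trivial when one of the three fused objects is the vacuum. *)
Definition F_vacuum : Prop :=
  [/\ (forall b c d mu nu, (mu < fus b c d)%N -> (nu < fus b c d)%N ->
        F vac b c d b 0 mu d nu 0 = (mu == nu)%:R),
      (forall a c d mu nu, (mu < fus a c d)%N -> (nu < fus a c d)%N ->
        F a vac c d a 0 mu c 0 nu = (mu == nu)%:R)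
    & (forall a b d mu nu, (mu < fus a b d)%N -> (nu < fus a b d)%N ->
        F a b vac d d mu 0 b 0 nu = (mu == nu)%:R)].

Definition pentagon : Prop := forall a b c d e f q y z al be ga mu nu la,
  (al < fus a b f)%N -> (be < fus f c q)%N -> (ga < fus q d e)%N ->
  (nu < fus c d z)%N -> (mu < fus b z y)%N -> (la < fus a y e)%N ->
  \sum_(de < fus f z e)
     F f c d e q be ga z nu de * F a b z e f al de y mu la
  = \sum_(p <- b ** c) \sum_(si < fus b c p) \sum_(ps < fus a p q)
      \sum_(rh < fus p d y)
        F a b c q f al be p si ps * F a p d e q ps ga y rh la
        * F b c d y p si rh z nu mu.

Definition R_unitary : Prop := forall a b c,
  (forall mu nu, (mu < fus a b c)%N -> (nu < fus a b c)%N ->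
    \sum_(la < fus a b c) Rs a b c mu la * (Rs a b c nu la)^*
    = (mu == nu)%:R) /\
  (forall mu nu, (mu < fus a b c)%N -> (nu < fus a b c)%N ->
    \sum_(la < fus a b c) (Rs a b c la mu)^* * Rs a b c la nu
    = (mu == nu)%:R).

Definition U_unitary : Prop := forall k a b c,
  (forall mu nu, (mu < fus a b c)%N -> (nu < fus a b c)%N ->
    \sum_(la < fus a b c) U k a b c mu la * (U k a b c nu la)^*
    = (mu == nu)%:R) /\
  (forall mu nu, (mu < fus a b c)%N -> (nu < fus a b c)%N ->
    \sum_(la < fus a b c) (U k a b c la mu)^* * U k a b c la nu
    = (mu == nu)%:R).

Definition eta_U_normalized : Prop :=
  [/\ (forall a b c mu nu, (mu < fus a b c)%N -> (nu < fus a b c)%N ->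
        U 1%g a b c mu nu = (mu == nu)%:R),
      (forall k a, U k a vac a 0 0 = 1 /\ U k vac a a 0 0 = 1),
      (forall g h, eta vac g h = 1),
      (forall a g, eta a g 1%g = 1 /\ eta a 1%g g = 1)
    & (forall a g h, `|eta a g h| = 1)].

(* The action of k commutes with F-moves. *)
Definition U_F : Prop := forall k a b c d e f al be mu nu,
  (al < fus a b e)%N -> (be < fus e c d)%N ->
  (mu < fus b c f)%N -> (nu < fus a f d)%N ->
  \sum_(mu' < fus b c f) \sum_(nu' < fus a f d)
     F (^!k a) (^!k b) (^!k c) (^!k d) (^!k e) al be (^!k f) mu' nu'
     * U k b c f mu' mu * U k a f d nu' nu
  = \sum_(al' < fus a b e) \sum_(be' < fus e c d)
     U k a b e al al' * U k e c d be be' * F a b c d e al' be' f mu nu.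

(* eta_a(k,l) eta_b(k,l) U_l(k^-1 a, k^-1 b; k^-1 c) U_k(a,b;c)
   = U_{kl}(a,b;c) eta_c(k,l) *)
Definition U_eta : Prop := forall k l a b c mu nu,
  (mu < fus a b c)%N -> (nu < fus a b c)%N ->
  eta a k l * eta b k l *
    \sum_(la < fus a b c) U l (^!k a) (^!k b) (^!k c) mu la * U k a b c la nu
  = U (k * l)%g a b c mu nu * eta c k l.

Definition eta_cocycle : Prop := forall a g h k,
  eta a g h * eta a (g * h)%g k = eta (^!g a) h k * eta a g (h * k)%g.

(* Crossing c over, resp. c under, a vertex (a,b;f), resp. (a,b;m). *)
Definition heptagon1 : Prop := forall a b c d e q al be mu nu,
  let k := gr c in
  (al < fus c (^!k a) e)%N -> (be < fus e (^!k b) d)%N ->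
  (mu < fus b c q)%N -> (nu < fus a q d)%N ->
  \sum_(la < fus a c e) \sum_(ga < fus c (^!k b) q)
     Rs a c e al la * F a c (^!k b) d e la be q ga nu * Rs b c q ga mu
  = \sum_(f <- a ** b) \sum_(si < fus c (^!k f) d) \sum_(de < fus a b f)
      \sum_(et < fus a b f) \sum_(ps < fus f c d)
        F c (^!k a) (^!k b) d e al be (^!k f) de si * U k a b f de et
        * Rs f c d si ps * F a b c d f et ps q mu nu.

Definition heptagon2 : Prop := forall a b c d e f al be mu nu,
  let g := gr a in let h := gr b in
  (al < fus c a e)%N -> (be < fus e b d)%N ->
  (mu < fus b (^!h (^!g c)) f)%N -> (nu < fus a f d)%N ->
  \sum_(la < fus a (^!g c) e) \sum_(ga < fus (^!g c) b f)
     Rinv c a e al la * F a (^!g c) b d e la be f ga nu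
     * Rinv (^!g c) b f ga mu
  = \sum_(m <- a ** b) \sum_(si < fus a b m) \sum_(de < fus c m d)
      \sum_(ps < fus m (^!(g * h)%g c) d)
        F c a b d e al be m si de * eta c g h * Rinv c m d de ps
        * F a b (^!h (^!g c)) d m si ps f mu nu.

Definition ribbon : Prop := forall a b c mu nu,
  let g := gr a in let h := gr b in
  (mu < fus a b c)%N -> (nu < fus a b c)%N ->
  \sum_(la < fus a b c) Rs b (^!h a) c mu la * Rs a b c la nu
  = twist c / (twist a * twist b)
    * (U (g * h)%g a b c mu nu / (eta a g h * eta b h (h^-1 * g * h)%g)).

(* Rigidity, and the fact that quantum dimensions give a character of the     *)
(* fusion ring which is invariant under duality.                              *)
Definition qdim_axioms : Prop :=
  [/\ (forall a, F a (dual a) a a vac 0 0 vac 0 0 != 0),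
      (forall a, qdim (dual a) = qdim a)
    & (forall a b,
        qdim a * qdim b = \sum_(c <- a ** b) (fus a b c)%:R * qdim c)].

(* C is a unitary (faithfully graded) G-crossed braided tensor category. *)
Record gcrossed_btc : Prop := GCrossedBTC {
  btc_fusion : fusion_axioms;
  btc_action : action_axioms;
  btc_F_unitary : F_unitary;
  btc_F_vacuum : F_vacuum;
  btc_pentagon : pentagon;
  btc_qdim : qdim_axioms;
  btc_R_unitary : R_unitary;
  btc_U_unitary : U_unitary;
  btc_normalized : eta_U_normalized;
  btc_U_F : U_F;
  btc_U_eta : U_eta;
  btc_eta_cocycle : eta_cocycle;
  btc_heptagon1 : heptagon1;
  btc_heptagon2 : heptagon2;
  btc_ribbon : ribbon
}.

(* S-matrix of the trivial sector, up to the positive normalization 1/D:      *)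
(* S_{ab} = sum_c N_{a,dual b}^c theta_c / (theta_a theta_b) d_c.             *)
Definition Smatrix : 'M[R[i]]_(size (sector C 1%g)) :=
  \matrix_(i, j)
    let a := nth vac (sector C 1%g) i in
    let b := nth vac (sector C 1%g) j in
    \sum_(c <- sector C 1%g)
      (fus a (dual b) c)%:R * (twist c / (twist a * twist b)) * qdim c.

(* The trivial sector of a G-crossed BTC is a unitary braided fusion category;*)
(* it is modular when its S-matrix is invertible.                             *)
Definition modular_trivial_sector : Prop := Smatrix \in unitmx.

Definition is_anyon a : bool := gr a == 1%g.
Definition abelian a : bool := qdim a == 1.

(* The group A of Abelian anyons. *)
Definition abelian_anyon : pred C := [pred a | is_anyon a && abelian a].

Definition no_permutation : Prop := forall k a, is_anyon a -> act k a = a.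

(* a x b, for Abelian a and b: their unique fusion channel. *)
Definition afus a b : C := head vac [seq c <- a ** b | fus a b c != 0%N].

Definition apow a (n : int) : C :=
  match n with
  | Posz m => iter m (afus a) vac
  | Negz m => iter m.+1 (afus (dual a)) vac
  end.

(* t . u = tx^{ux} x ty^{uy} *)
Definition tdot (t : C * C) (u : 'cV[int]_2) : C :=
  afus (apow t.1 (u 0 0)) (apow t.2 (u 1 0)).

(* R^{a,b} for Abelian a and b. *)
Definition Rab a b : R[i] := Rs a b (afus a b) 0 0.

(* The double braid M_{a,b}. *)
Definition double_braid a b : R[i] := Rab a b * Rab b a.

(* I_M(d) = theta_d^M prod_{j < M} eta_d(g, g^j), for d a g-defect *)
Definition Iinv (M : nat) d : R[i] :=
  twist d ^+ M * \prod_(j < M) eta d (gr d) (gr d ^+ j)%g.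

End GCrossed.

(* s^{(h1 + h2 - [h1 + h2]_M) / M} x t . ((1 - h)^-1 (1 - h^h1) r2) *)
Definition frac_cocycle (R : realType) (M : nat) (h : lattice_rotation R M)
    (phi : rat) (C : gcrossed_data R (sym_group h phi)) (s : C) (t : C * C)
    (g1 g2 : sym_group h phi) : C :=
  let h1 : nat := angle g1 in
  let h2 : nat := angle g2 in
  afus (apow s ((h1 + h2 - (h1 + h2) %% M) %/ M)%N)
       (tdot t (geom_mx h h1 *m trans g2)).

(* Main.v *)
Require Import Defs.
From mathcomp Require Import all_boot all_order all_algebra.
From mathcomp Require Import complex reals.
From mathcomp Require Import ring zify.
Import Order.TTheory GRing.Theory Num.Theory.

Local Open Scope ring_scope.

(* For an Abelian g-defect d with g^M = 1 one has I_M(d)^M = theta_{d^M}: the  *)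
(* powers of d commute, so the G-action fixes them, and the heptagon and       *)
(* ribbon equations express theta_{d^(n+1)} through theta_{d^n}, with the      *)
(* U-symbols telescoping to those of g^M. As d_i^M = s x t.(M (1 - h)^-1 r_i), *)
(* the left-hand side is a second difference of theta on the Abelian anyons,   *)
(* that is, the bicharacter M_{a,b} associated with this quadratic function.   *)

(** Fusion with an Abelian object has a single channel of multiplicity one, so on Abelian objects
    every sum in the axioms collapses to a scalar identity. Let [d] be an Abelian g-defect and write
    D_n for the double braid of d^n with d. All powers of [d] commute, hence are fixed by the powers
    of g. Comparing the two heptagons gives D_(n+1) U_g(d, d^n) = theta_d^2 D_n eta_d(g, g^n)
    ([double_braid_mul], [double_braid_iter]). The ribbon equation ([twist_afus]) expresses
    theta_(d^(n+1)) through theta_(d^n), D_n and eta symbols, and the U-eta equation ([eta_iter])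
    moves the U-symbols from g^(n+1) to g and g^n. Induction yields [twist_iter], which for g^M = 1
    reads theta_(d^M) = I_M(d)^M, because U at the identity is 1.

    On Abelian anyons theta is a quadratic function whose polar form is the bicharacter M_(a,b). On
    the group side, multiplying out d^M with the given cocycle produces one carry, contributing s,
    and translation parts adding up to sum_(j < M) (1 - h)^-1 (1 - h^j) = M (1 - h)^-1
    ([sum_geom_mx], [apow_defect]). The quotient of invariants is thus a second difference of theta
    based at s ([twist_second_difference]). *)

Section AbelianObjects.
Set Implicit Arguments.
Unset Strict Implicit.
Unset Printing Implicit Defensive.

Variables (R : realType) (G : groupType) (C : gcrossed_data R G).
Hypothesis HC : gcrossed_btc C.
Implicit Types (a b c d e x : C) (g k l : G).

Local Notation gr := (@grade R G C).
Local Notation vac := (vacuum C).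
Local Notation dual := (@dual_obj R G C).
Local Notation fus := (@fusN R G C).
Local Notation act := (@gact R G C).
Local Notation U := (@Usym R G C).
Local Notation "a ** b" := (sector C (gr a * gr b)%g) (at level 40).

(** * Fusion of Abelian objects *)

Lemma fus_sector a b c : fus a b c != 0%N -> c \in a ** b.
Proof.
by have [[_ mem_sec _ gr_fus _] _] := btc_fusion HC => /gr_fus;
  rewrite mem_sec => ->.
Qed.

Lemma sector_uniq g : uniq (sector C g).
Proof. by have [[]] := btc_fusion HC. Qed.

Lemma big_channel (V : Type) (idx : V) (op : Monoid.com_law idx) a b f
    (K : C -> V) :
  fus a b f != 0%N -> (forall e, e != f -> fus a b e = 0%N) ->
  (forall e, fus a b e = 0%N -> K e = idx) ->
  \big[op/idx]_(e <- a ** b) K e = K f.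
Proof.
move=> nf uf K0; rewrite (bigD1_seq f) ?fus_sector ?sector_uniq //=.
by rewrite big1 ?Monoid.mulm1 // => e /uf /K0.
Qed.

Lemma qdim_gt0 a : 0 < qdim a.
Proof.
have [nz _ _] := btc_qdim HC.
by rewrite /qdim invr_gt0 normr_gt0 nz.
Qed.

Lemma dualK a : dual (dual a) = a.
Proof. by have [_ []] := btc_fusion HC. Qed.

Lemma fus_vac a : fus a (dual a) vac = 1%N.
Proof. by have [_ [_ _ _ -> _]] := btc_fusion HC; rewrite eqxx. Qed.

Lemma dual_vac : dual vac = vac.
Proof.
have [_ [_ fv _ fd _]] := btc_fusion HC.
by have := fd vac vac; rewrite fv eqxx; case: eqP.
Qed.

Lemma abelian_vac : abelian vac.
Proof.
have [_ [_ fv _ _ _]] := btc_fusion HC.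
have [F1 _ _] := btc_F_vacuum HC.
by rewrite /abelian /qdim dual_vac F1 ?fv ?eqxx // normr1 invr1.
Qed.

Lemma abelian_dual a : abelian a -> abelian (dual a).
Proof. by have [_ qd _] := btc_qdim HC; rewrite /abelian qd. Qed.

(** The dimensions of the channels add up to 1, which [vac] already exhausts; any further channel
    would contribute a positive dimension. *)
Lemma fus_dual_abelian a c : abelian a -> fus a (dual a) c = (c == vac).
Proof.
move=> Aa; have [_ qd qM] := btc_qdim HC.
have [-> |cv] := eqVneq c vac; first exact: fus_vac.
apply/eqP; apply: contraT => fc.
have := qM a (dual a); rewrite qd (eqP Aa) mulr1.
rewrite (bigD1_seq vac) ?sector_uniq ?fus_sector ?fus_vac //=.
rewrite (eqP abelian_vac) mulr1 -[LHS]addr0 => /addrI /esym S0.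
have : 0 < \sum_(e <- a ** dual a | e != vac)
    (fus a (dual a) e)%:R * qdim e :> R[i].
  rewrite -big_filter (bigD1_seq c) ?filter_uniq ?sector_uniq //=; last first.
    by rewrite mem_filter cv fus_sector.
  apply: ltr_wpDr; last by rewrite mulr_gt0 ?qdim_gt0 // ltr0n lt0n.
  by apply: sumr_ge0 => e _; rewrite mulr_ge0 ?ler0n // ltW ?qdim_gt0.
by rewrite S0 ltxx.
Qed.

Lemma fus_ex a b : exists c, fus a b c != 0%N.
Proof.
have [_ _ qM] := btc_qdim HC; have := mulr_gt0 (qdim_gt0 a) (qdim_gt0 b).
rewrite qM => S0.
have /hasP[c _ nc] : has (fun c => fus a b c != 0%N) (a ** b).
  apply: contraLR S0 => /hasPn f0; rewrite big_seq big1 ?ltxx // => c /f0.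
  by rewrite negbK => /eqP ->; rewrite mul0r.
by exists c.
Qed.

(* Bracketing (dual a, a, b) both ways leaves room for a single channel of     *)
(* a x b, of multiplicity one.                                                *)
Lemma fus_abelian_ex a b : abelian a -> exists f, forall c, fus a b c = (c == f).
Proof.
move=> Aa; have [[_ _ _ _ fA] [_ fv _ _ _]] := btc_fusion HC.
have da := abelian_dual Aa.
have E x : ((b == x) = \sum_(f <- a ** b) fus a b f * fus (dual a) f x :> nat)%N.
  rewrite -fA (@big_channel _ _ _ _ _ vac) //=.
  - by rewrite -{2}[a]dualK fus_vac mul1n fv.
  - by rewrite -{2}[a]dualK fus_vac.
  - by move=> e /negPf ev; rewrite -{2}[a]dualK fus_dual_abelian // ev.
  - by move=> e ->; rewrite mul0n.
have back c : fus a b c != 0%N -> (0 < fus (dual a) c b)%N.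
  move=> fc; have [x fx] := fus_ex (dual a) c.
  have := E x; rewrite (bigD1_seq c) ?sector_uniq ?fus_sector //=.
  case: (b =P x) => [bx|_ /eqP]; first by rewrite bx lt0n.
  by rewrite eq_sym addn_eq0 muln_eq0 (negPf fc) (negPf fx).
have [f nf] := fus_ex a b; exists f => c.
have := E b; rewrite eqxx (bigD1_seq f) ?sector_uniq ?fus_sector //= => Eb.
have nmf : (0 < fus a b f * fus (dual a) f b)%N by rewrite muln_gt0 lt0n nf back.
have [->|cf] := eqVneq c f.
  have /eqP : (fus a b f * fus (dual a) f b)%N = 1%N.
    by apply/eqP; rewrite eqn_leq nmf andbT Eb leq_addr.
  by rewrite muln_eq1 => /andP[/eqP].
apply/eqP; apply: contraT => nc; move: Eb.
rewrite -big_filter (bigD1_seq c) ?filter_uniq ?sector_uniq //=; last first.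
  by rewrite mem_filter cf fus_sector.
have nmc : (0 < fus a b c * fus (dual a) c b)%N by rewrite muln_gt0 lt0n nc back.
by case: (_ * _)%N nmf => // i _; case: (_ * _)%N nmc => // j _; rewrite addSn addnS.
Qed.

(** The list whose head defines [afus] contains only the unique channel, so the default [vac] is
    never returned by accident. *)
Lemma fus_abelian a b c : abelian a -> fus a b c = (c == afus a b).
Proof.
move=> /(fus_abelian_ex b)[f Ef]; suff -> : afus a b = f by rewrite Ef.
have : f \in [seq e <- a ** b | fus a b e != 0%N].
  by rewrite mem_filter andbC fus_sector Ef eqxx.
rewrite /afus; case Es: [seq e <- _ | _] => [//|x l] _ /=.
have : x \in x :: l by rewrite inE eqxx.
by rewrite -Es mem_filter Ef; case: (x =P f).
Qed.

Lemma fus_afus a b : abelian a -> fus a b (afus a b) = 1%N.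
Proof. by move=> Aa; rewrite fus_abelian ?eqxx. Qed.

Lemma big_channel_abelian (V : Type) (idx : V) (op : Monoid.com_law idx) a b
    (K : C -> V) : abelian a ->
  (forall e, fus a b e = 0%N -> K e = idx) ->
  \big[op/idx]_(e <- a ** b) K e = K (afus a b).
Proof.
move=> Aa; apply: big_channel; first by rewrite fus_afus.
by move=> e /negPf ne; rewrite fus_abelian ?ne.
Qed.

Lemma gr_afus a b : abelian a -> gr (afus a b) = (gr a * gr b)%g.
Proof.
have [[_ _ _ grf _] _] := btc_fusion HC.
by move=> Aa; apply: grf; rewrite fus_afus.
Qed.

Lemma qdim_afus a b : abelian a -> qdim (afus a b) = qdim b.
Proof.
have [_ _ qM] := btc_qdim HC => Aa.
have := qM a b; rewrite (big_channel_abelian _ Aa) => [|e ->]; last by rewrite mul0r.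
by rewrite fus_afus // (eqP Aa) !mul1r.
Qed.

Lemma abelian_afus a b : abelian a -> abelian b -> abelian (afus a b).
Proof. by move=> Aa; rewrite /abelian qdim_afus. Qed.

Lemma afusA a b c : abelian a -> abelian b ->
  afus a (afus b c) = afus (afus a b) c.
Proof.
have [[_ _ _ _ fA] _] := btc_fusion HC => Aa Ab.
have Aab := abelian_afus Aa Ab.
have := fA a b c (afus a (afus b c)).
rewrite !big_channel_abelian //= => [|e ->|e ->]; rewrite ?mul0n //.
by rewrite !fus_afus // fus_abelian //; case: eqP.
Qed.

Lemma afus1g a : afus vac a = a.
Proof.
have [_ [_ fv _ _ _]] := btc_fusion HC.
by have := fus_afus a abelian_vac; rewrite fv; case: eqP.
Qed.

Lemma afusg1 a : abelian a -> afus a vac = a.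
Proof.
have [_ [_ _ fv _ _]] := btc_fusion HC => Aa.
by have := fus_afus vac Aa; rewrite fv; case: eqP.
Qed.

Lemma afusgV a : abelian a -> afus a (dual a) = vac.
Proof.
by move=> Aa; have := fus_vac a; rewrite fus_abelian //; case: eqP => // ->.
Qed.

Lemma afusVg a : abelian a -> afus (dual a) a = vac.
Proof. by move=> /abelian_dual/afusgV; rewrite dualK. Qed.

Lemma afusKg a b : abelian a -> afus (dual a) (afus a b) = b.
Proof. by move=> Aa; rewrite afusA ?abelian_dual // afusVg // afus1g. Qed.

Lemma afusVKg a b : abelian a -> afus a (afus (dual a) b) = b.
Proof. by move=> Aa; rewrite afusA ?abelian_dual // afusgV // afus1g. Qed.

Lemma afusI a b c : abelian a -> afus a b = afus a c -> b = c.
Proof. by move=> Aa E; rewrite -(afusKg b Aa) E afusKg. Qed.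

(** Crossing [a] past [b] gives a x b = b x a', with a' the image of [a] under the inverse grade of
    [b]; comparing with b x a and cancelling [b] gives a' = a. *)
Lemma act_commute a b : abelian a -> abelian b -> afus a b = afus b a ->
  act (gr b)^-1%g a = a.
Proof.
have [_ [_ _ fus_act]] := btc_action HC => Aa Ab ab.
apply: (afusI Ab); have := fus_act a b (afus a b).
by rewrite fus_afus // fus_abelian // -ab; case: eqP.
Qed.

Lemma commute_afus a b c : abelian a -> abelian b -> abelian c ->
  afus a c = afus c a -> afus b c = afus c b ->
  afus (afus a b) c = afus c (afus a b).
Proof. by move=> Aa Ab Ac ac bc; rewrite -afusA // bc afusA // ac afusA. Qed.

(** * The consistency equations on commuting Abelian objects *)

Definition Uab k a b : R[i] := U k a b (afus a b) 0 0.

Lemma mul_eq1_neq0 (z w : R[i]) : z * w = 1 -> z != 0.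
Proof. by apply: contra_eq_neq => ->; rewrite mul0r eq_sym oner_eq0. Qed.

Lemma Rab_conj a b : abelian a -> Rab a b * (Rab a b)^* = 1.
Proof.
move=> Aa; have [/(_ 0%N 0%N) + _] := btc_R_unitary HC a b (afus a b).
by rewrite fus_afus // big_ord1; apply.
Qed.

Lemma Rab_neq0 a b : abelian a -> Rab a b != 0.
Proof. by move=> /(Rab_conj b) /mul_eq1_neq0. Qed.

Lemma F_neq0 a b c : abelian a -> abelian b -> abelian c ->
  Fsym a b c (afus a (afus b c)) (afus a b) 0 0 (afus b c) 0 0 != 0.
Proof.
move=> Aa Ab Ac; have Aab := abelian_afus Aa Ab.
have [/(_ (afus a b) 0 0 (afus a b) 0 0)%N + _] :=
  btc_F_unitary HC a b c (afus a (afus b c)).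
rewrite [in fus (afus a b) c _]afusA // !fus_afus // => /(_ isT isT isT isT).
rewrite (big_channel_abelian _ Ab) => [|e ->]; last by rewrite big_ord0.
by rewrite !fus_afus // !big_ord1 eqxx; apply: mul_eq1_neq0.
Qed.

Lemma eta_neq0 a g k : eta a g k != 0.
Proof.
have [_ _ _ _ n1] := btc_normalized HC.
by rewrite -normr_eq0 n1 oner_eq0.
Qed.

Lemma twist_abelian a : abelian a -> twist a = Rab a a.
Proof.
move=> Aa; rewrite /twist (big_channel_abelian _ Aa) => [|e ->]; last by rewrite big_ord0.
by rewrite fus_afus // big_ord1 qdim_afus // divff ?mul1r // (eqP Aa) oner_eq0.
Qed.

Lemma twist_neq0 a : abelian a -> twist a != 0.
Proof. by move=> Aa; rewrite twist_abelian // Rab_neq0. Qed.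

(* The two heptagons involve the same three F-symbols, which cancel.          *)
Lemma double_braid_mul a b c : abelian a -> abelian b -> abelian c ->
  afus a b = afus b a -> afus a c = afus c a -> afus b c = afus c b ->
  double_braid (afus a b) c * Uab (gr c) a b =
  double_braid a c * double_braid b c * eta c (gr a) (gr b).
Proof.
move=> Aa Ab Ac ab ac bc.
have Aab := abelian_afus Aa Ab.
have Aac := abelian_afus Aa Ac.
have abc := commute_afus Aa Ab Ac ac bc.
have Eac : afus (afus a c) b = afus a (afus b c) by rewrite -afusA // bc.
have Eab : afus (afus a b) c = afus a (afus b c) by rewrite afusA.
have Eca : afus c (afus a b) = afus a (afus b c) by rewrite -abc.
have aKc := act_commute Aa Ac ac.
have bKc := act_commute Ab Ac bc.
have abKc := act_commute Aab Ac abc.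
have cKa := act_commute Ac Aa (esym ac).
have cKb := act_commute Ac Ab (esym bc).
have cKab := act_commute Ac Aab (esym abc).
rewrite gr_afus // in cKab.
pose d := afus a (afus b c); pose e := afus a c.
pose q := afus b c; pose f := afus a b.
have fe1 : fus c a e = 1%N by rewrite /e ac fus_afus.
have fe2 : fus a c e = 1%N by rewrite fus_afus.
have fq1 : fus c b q = 1%N by rewrite /q bc fus_afus.
have fq2 : fus b c q = 1%N by rewrite fus_afus.
have fd1 : fus e b d = 1%N by rewrite /d -Eac fus_afus.
have fd2 : fus a q d = 1%N by rewrite fus_afus.
have fd3 : fus f c d = 1%N by rewrite /d -Eab fus_afus.
have fd4 : fus c f d = 1%N by rewrite /d -Eca fus_afus.
have ff : fus a b f = 1%N by rewrite fus_afus.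
have H1 := btc_heptagon1 HC (a := a) (b := b) (c := c) (d := d) (e := e)
  (q := q) (al := 0%N) (be := 0%N) (mu := 0%N) (nu := 0%N).
have H2 := btc_heptagon2 HC (a := a) (b := b) (c := c) (d := d) (e := e)
  (f := q) (al := 0%N) (be := 0%N) (mu := 0%N) (nu := 0%N).
move: H1; rewrite /= aKc bKc fe1 fe2 fq1 fq2 fd1 fd2 => /(_ isT isT isT isT).
rewrite (big_channel_abelian _ Aa) => [|x fx]; last first.
  by apply: big1 => i _; rewrite fx big_ord0.
rewrite -/f abKc ff fd3 fd4 !big_ord1 /= => H1.
move: H2; rewrite /= cKa cKb fe1 fe2 fq1 fq2 fd1 fd2 => /(_ isT isT isT isT).
rewrite (big_channel_abelian _ Aa) => [|x fx]; last by rewrite fx big_ord0.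
rewrite -/f cKab ff fd3 fd4 !big_ord1 /= /Rinv => H2.
have Y0 := F_neq0 Ac Aa Ab; rewrite Eca -ac -/d -/e -/f in Y0.
have Z0 := F_neq0 Aa Ab Ac; rewrite -/d -/q -/f in Z0.
have Rca : Rsym c a e 0 0 = Rab c a by rewrite /Rab -ac.
have Rcb : Rsym c b q 0 0 = Rab c b by rewrite /Rab -bc.
have Rfc : Rsym f c d 0 0 = Rab f c by rewrite /Rab Eab.
have Rcf : Rsym c f d 0 0 = Rab c f by rewrite /Rab Eca.
rewrite Rfc -[Rsym a c e 0 0]/(Rab a c) -[Rsym b c q 0 0]/(Rab b c) in H1.
rewrite Rca Rcb Rcf in H2.
have ca1 := Rab_conj a Ac; have cb1 := Rab_conj b Ac; have cf1 := Rab_conj f Ac.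
apply: (mulfI (mulf_neq0 Y0 Z0)); rewrite /double_braid /Uab -/f.
rewrite -/f in H1 H2.
(* With X, Y, Z the F-symbols of (a,c,b), (c,a,b), (a,b,c), [H1] says R^{a,c} X R^{b,c} = Y U
   R^{ab,c} Z, and [H2] says that X times the inverses of R^{c,a} and R^{c,b} is Y eta Z times the
   inverse of R^{c,ab}. Dividing eliminates X, Y and Z. *)
move: H1 H2 ca1 cb1 cf1; clear.
set Y := Fsym c a b _ _ _ _ _ _ _; set Z := Fsym a b c _ _ _ _ _ _ _.
set X := Fsym a c b _ _ _ _ _ _ _; set u := U _ _ _ _ _ _.
set yc := (Rab c a)^*%C; set zc := (Rab c b)^*%C; set rc := (Rab c f)^*%C.
set y := Rab c a; set z := Rab c b; set r := Rab c f; set n := eta _ _ _.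
move=> H1 H2 y1 z1 r1.
transitivity (r * (Y * u * Rab f c * Z)); first by ring.
rewrite -H1.
transitivity (r * (Rab a c * Rab b c) * ((y * yc) * (z * zc) * X)).
  by rewrite y1 z1; ring.
transitivity (r * (Rab a c * Rab b c) * (y * z) * (yc * X * zc)); first by ring.
rewrite H2; transitivity (Y * Z * (Rab a c * y * (Rab b c * z) * n) * (r * rc)).
  by ring.
by rewrite r1 mulr1.
Qed.

(** The ribbon equation: commuting objects have commuting grades, so the conjugated grade in its
    second eta symbol reduces to [gr a]. *)
Lemma twist_afus a b : abelian a -> abelian b -> afus a b = afus b a ->
  twist (afus a b) * Uab (gr a * gr b)%g a b =
  twist a * twist b * double_braid a b *
  (eta a (gr a) (gr b) * eta b (gr b) (gr a)).
Proof.
move=> Aa Ab ab; have aKb := act_commute Aa Ab ab.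
have gC : ((gr b)^-1 * gr a * gr b)%g = gr a.
  by rewrite -mulgA -gr_afus // ab gr_afus // mulgA mulVg mul1g.
have := btc_ribbon HC (a := a) (b := b) (c := afus a b) (mu := 0%N) (nu := 0%N).
rewrite /= fus_afus // big_ord1 /= aKb gC => /(_ isT isT) rib.
have -> : double_braid a b = Rsym b a (afus a b) 0 0 * Rsym a b (afus a b) 0 0.
  by rewrite /double_braid mulrC /Rab -ab.
rewrite rib /Uab; field.
by rewrite !eta_neq0 !twist_neq0.
Qed.

Lemma eta_afus a b k l : abelian a -> abelian b ->
  act k^-1%g a = a -> act k^-1%g b = b ->
  eta (afus a b) k l * Uab (k * l)%g a b =
  eta a k l * eta b k l * (Uab l a b * Uab k a b).
Proof.
move=> Aa Ab ka kb.
have kab : act k^-1%g (afus a b) = afus a b.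
  have [_ [_ fus_inv _]] := btc_action HC.
  have := fus_inv k^-1%g a b (afus a b).
  by rewrite ka kb fus_afus // fus_abelian //; case: eqP.
have := btc_U_eta HC k l (a := a) (b := b) (c := afus a b) (mu := 0%N) (nu := 0%N).
rewrite ka kb kab fus_afus // => /(_ isT isT).
by rewrite big_ord1 /= /Uab => ->; rewrite mulrC.
Qed.

(** Multiplicativity at vac x vac = vac makes this nonzero scalar idempotent. *)
Lemma double_braid_vac a : abelian a -> double_braid vac a = 1.
Proof.
move=> Aa; have Av := abelian_vac.
have va : afus vac a = afus a vac by rewrite afus1g afusg1.
have := double_braid_mul Av Av Aa (erefl _) va va.
have [_ /(_ (gr a) vac)[_ U1] _ /(_ a (gr vac))[eta1 _] _] := btc_normalized HC.
have [_ [gv _ _ _ _]] := btc_fusion HC.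
rewrite /Uab afus1g U1 gv in eta1 *; rewrite eta1 !mulr1 -[LHS]mulr1 => /mulfI -> //.
by rewrite mulf_neq0 // Rab_neq0.
Qed.

(** * Twists of the powers of one Abelian defect *)

Section Powers.
Variable d : C.
Hypothesis Ad : abelian d.
Local Notation pw n := (iter n (afus d) vac).
Local Notation g := (gr d).

Lemma abelian_iter n : abelian (pw n).
Proof. by elim: n => [|n IHn]; [exact: abelian_vac | apply: abelian_afus]. Qed.

Lemma gr_iter n : gr (pw n) = (g ^+ n)%g.
Proof.
have [_ [gv _ _ _ _]] := btc_fusion HC.
by elim: n => [|n IHn] //=; rewrite gr_afus // IHn expgS.
Qed.

Lemma iter_commute n : afus d (pw n) = afus (pw n) d.
Proof.
elim: n => [|n IHn] /=; first by rewrite afus1g afusg1.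
by rewrite -afusA ?abelian_iter // -IHn.
Qed.

Lemma iter_commute2 m n : afus (pw m) (pw n) = afus (pw n) (pw m).
Proof.
elim: m => [|m IHm] /=; first by rewrite afus1g afusg1 ?abelian_iter.
by apply: commute_afus; rewrite ?abelian_iter // iter_commute.
Qed.

Lemma act_iter m n : act (g ^+ m)^-1%g (pw n) = pw n.
Proof.
by rewrite -gr_iter; apply: act_commute; rewrite ?abelian_iter // iter_commute2.
Qed.

Lemma act_iter1 m : act (g ^+ m)^-1%g d = d.
Proof. by have := act_iter m 1; rewrite /= afusg1. Qed.

(** Each further factor [d] contributes M_(d,d) = theta_d^2 and one eta symbol, by
    [double_braid_mul]. *)
Lemma double_braid_iter n :
  double_braid (pw n) d * \prod_(j < n) Uab g d (pw j) =
  twist d ^+ (2 * n) * \prod_(j < n) eta d g (g ^+ j)%g.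
Proof.
elim: n => [|n IHn]; first by rewrite !big_ord0 double_braid_vac.
rewrite !big_ord_recr /=.
have := double_braid_mul Ad (abelian_iter n) Ad (iter_commute n) (erefl _)
  (esym (iter_commute n)).
rewrite gr_iter {2}/double_braid -twist_abelian // => E.
rewrite [X in _ * X = _]mulrC [LHS]mulrA E [X in X * _ = _]mulrAC.
rewrite -[LHS]mulrA IHn mulnS exprD; ring.
Qed.

Lemma eta_iter n p q :
  eta (pw n) (g ^+ p)%g (g ^+ q)%g
    * \prod_(i < n) Uab (g ^+ p * g ^+ q)%g d (pw i) =
  eta d (g ^+ p)%g (g ^+ q)%g ^+ n
    * (\prod_(i < n) Uab (g ^+ q)%g d (pw i)
       * \prod_(i < n) Uab (g ^+ p)%g d (pw i)).
Proof.
have [_ _ eta_vac _ _] := btc_normalized HC.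
elim: n => [|n IHn]; first by rewrite !big_ord0 eta_vac !mulr1 expr0.
have := eta_afus (g ^+ q)%g Ad (abelian_iter n) (act_iter1 p) (act_iter p n).
rewrite !big_ord_recr /= => E; rewrite [X in _ * X = _]mulrC [LHS]mulrA E.
rewrite exprS; move: IHn.
set x := eta (pw n) _ _; set y := eta d _ _; set P := \prod_(i < n) _.
by set P1 := \prod_(i < n) _; set P2 := \prod_(i < n) _ => IHn; ring: IHn.
Qed.

(** The cocycle equation at (g, g^n, g), where [d] is fixed by g, propagates the symmetry from n to
    n + 1. *)
Lemma eta_sym n : eta d (g ^+ n)%g g = eta d g (g ^+ n)%g.
Proof.
have [_ _ _ /(_ d g)[e1 e2] _] := btc_normalized HC.
elim: n => [|n IHn]; first by rewrite expg0 e1 e2.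
have := btc_eta_cocycle HC d g (g ^+ n)%g g.
have := act_iter1 1; rewrite expg1 => ->.
by rewrite -expgS -expgSr IHn => /mulfI; apply; rewrite eta_neq0.
Qed.

Lemma twist_vac : twist vac = 1.
Proof.
have Av := abelian_vac; have [_ [gv _ _ _ _]] := btc_fusion HC.
have [_ /(_ 1%g vac)[U1 _] eta1 _ _] := btc_normalized HC.
have := twist_afus Av Av (erefl _).
rewrite /Uab afus1g gv mulg1 U1 !eta1 double_braid_vac // !mulr1 => /esym tt.
by apply: (mulfI (twist_neq0 Av)); rewrite mulr1.
Qed.

(** The product of U-symbols is kept on the left so that the induction closes for all n; it
    disappears once g^n = 1. *)
Lemma twist_iter n :
  twist (pw n) * \prod_(i < n) Uab (g ^+ n)%g d (pw i) =
  (twist d ^+ n * \prod_(j < n) eta d g (g ^+ j)%g) ^+ n.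
Proof.
elim: n => [|n IHn]; first by rewrite big_ord0 mulr1 twist_vac.
have tw := twist_afus Ad (abelian_iter n) (iter_commute n).
have db := double_braid_iter n.
(* This choice trades the U-symbols of g^(n+1) for those of g, which [double_braid_iter] absorbs,
   and those of g^n, which the induction hypothesis absorbs. *)
have et := eta_iter n n 1.
rewrite expg1 eta_sym -expgSr in et.
rewrite gr_iter -expgS /double_braid in tw.
rewrite [Rab d _ * _]mulrC -/(double_braid (pw n) d) in tw.
rewrite [X in _ * X = _]big_ord_recr [X in _ = (_ * X) ^+ _]big_ord_recr /=.
move: tw db et IHn.
set U1 := \prod_(j < n) Uab g d _; set Un := \prod_(j < n) Uab (g ^+ n)%g d _.
set E := \prod_(i < n) eta _ _ _; set V := \prod_(i < n) _; set e := eta d _ _.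
set f := eta (pw n) _ _; set t := twist d; set u := Uab _ _ _.
set D := double_braid _ _ => tw db et IHn.
transitivity (V * (twist (afus d (pw n)) * u)); first by ring.
rewrite tw; transitivity (t * twist (pw n) * D * e * (f * V)); first by ring.
rewrite et; transitivity (t * (twist (pw n) * Un) * (D * U1) * e ^+ n.+1).
  by rewrite exprS; ring.
rewrite IHn db !exprMn -!exprM.
(* Powers of theta_d: one from the ribbon equation, n * n from the induction hypothesis, 2 * n from
   the double braid. *)
have -> : (n.+1 * n.+1 = 1 + n * n + 2 * n)%N.
  by rewrite mulnS mulSn; lia.
by rewrite !exprD expr1 [E ^+ n.+1]exprS; ring.
Qed.

Lemma twist_iter_order M : (g ^+ M)%g = 1%g -> twist (pw M) = Iinv M d ^+ M.
Proof.
move=> gM; rewrite /Iinv -twist_iter gM big1 ?mulr1 // => i _.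
have [U1 _ _ _ _] := btc_normalized HC.
by rewrite /Uab U1 ?fus_afus ?abelian_iter.
Qed.

End Powers.

(** * Abelian anyons: the twist as a quadratic function, and integer powers *)

Hypothesis Hperm : no_permutation C.

Lemma anyon_abelian a : abelian_anyon a -> abelian a.
Proof. by case/andP. Qed.

Lemma anyon_gr a : abelian_anyon a -> gr a = 1%g.
Proof. by case/andP => /eqP. Qed.

(** The crossed braiding commutes [a] past [b] up to the action on [a], which is trivial on anyons;
    [b] may be a defect. *)
Lemma anyon_commute a b : abelian_anyon a -> abelian b -> afus a b = afus b a.
Proof.
case/andP => ga Aa Ab; have [_ [_ _ fus_act]] := btc_action HC.
have := fus_act a b (afus a b); rewrite Hperm // fus_afus // fus_abelian //.
by case: eqP.
Qed.

Lemma anyon_vac : abelian_anyon vac.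
Proof.
by have [_ [gv _ _ _ _]] := btc_fusion HC;
  rewrite /abelian_anyon /= /is_anyon gv eqxx abelian_vac.
Qed.

Lemma anyon_afus a b : abelian_anyon a -> abelian_anyon b ->
  abelian_anyon (afus a b).
Proof.
case/andP => /eqP ga Aa /andP[/eqP gb Ab].
by rewrite /abelian_anyon /= /is_anyon gr_afus // ga gb mulg1 eqxx abelian_afus.
Qed.

Lemma anyon_dual a : abelian_anyon a -> abelian_anyon (dual a).
Proof.
case/andP => /eqP ga Aa; rewrite /abelian_anyon /= abelian_dual // andbT.
have [_ [gv _ _ _ _]] := btc_fusion HC.
by rewrite /is_anyon -[gr _]mul1g -{1}ga -gr_afus // afusgV // gv.
Qed.

Lemma anyon_afusACA a b c d : abelian_anyon a -> abelian_anyon b ->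
  abelian_anyon c -> abelian d ->
  afus (afus a b) (afus c d) = afus (afus a c) (afus b d).
Proof.
move=> Ha Hb Hc Ad.
have [[Aa Ab] Ac] := (anyon_abelian Ha, anyon_abelian Hb, anyon_abelian Hc).
rewrite -!afusA ?abelian_afus //; congr afus.
by rewrite !afusA // (anyon_commute Hb Ac).
Qed.

Lemma double_braid_anyonM a b c : abelian_anyon a -> abelian_anyon b ->
  abelian_anyon c ->
  double_braid (afus a b) c = double_braid a c * double_braid b c.
Proof.
move=> Ha Hb Hc.
have [[Aa Ab] Ac] := (anyon_abelian Ha, anyon_abelian Hb, anyon_abelian Hc).
have [U1 _ _ /(_ c 1%g)[eta1 _] _] := btc_normalized HC.
have := double_braid_mul Aa Ab Ac (anyon_commute Ha Ab) (anyon_commute Ha Ac)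
  (anyon_commute Hb Ac).
by rewrite !anyon_gr // /Uab U1 ?fus_afus // eta1 !mulr1.
Qed.

Lemma twist_anyonM a b : abelian_anyon a -> abelian_anyon b ->
  twist (afus a b) = twist a * twist b * double_braid a b.
Proof.
move=> Ha Hb; have [Aa Ab] := (anyon_abelian Ha, anyon_abelian Hb).
have [U1 _ _ eta1 _] := btc_normalized HC.
have := twist_afus Aa Ab (anyon_commute Ha Ab).
rewrite !anyon_gr // mulg1 /Uab U1 ?fus_afus //.
by have [-> _] := eta1 a 1%g; have [-> _] := eta1 b 1%g; rewrite !mulr1.
Qed.

Lemma double_braid_neq0 a b : abelian a -> abelian b -> double_braid a b != 0.
Proof. by move=> Aa Ab; rewrite mulf_neq0 ?Rab_neq0. Qed.

(** Expanding every twist by [twist_anyonM], the terms involving [s] cancel by bilinearity and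
    symmetry of the double braid. *)
Lemma twist_second_difference s x y : abelian_anyon s -> abelian_anyon x ->
  abelian_anyon y ->
  twist (afus s (afus x y)) * twist s / (twist (afus s y) * twist (afus s x))
  = double_braid x y.
Proof.
move=> Hs Hx Hy.
have [[As Ax] Ay] := (anyon_abelian Hs, anyon_abelian Hx, anyon_abelian Hy).
rewrite !twist_anyonM ?anyon_afus //.
have dC a b : double_braid a b = double_braid b a by rewrite /double_braid mulrC.
rewrite [double_braid s (afus _ _)]dC double_braid_anyonM //
  [double_braid x s]dC [double_braid y s]dC.
by field; rewrite !double_braid_neq0 ?twist_neq0.
Qed.

Lemma anyon_apow a m : abelian_anyon a -> abelian_anyon (apow a m).
Proof.
have it b n : abelian_anyon b -> abelian_anyon (iter n (afus b) vac).
  by move=> Hb; elim: n => [|n]; [exact: anyon_vac | exact: anyon_afus].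
by move=> Ha; case: m => n; apply: it; rewrite ?anyon_dual.
Qed.

Lemma apowS a m : abelian a -> apow a (1 + m) = afus a (apow a m).
Proof.
move=> Aa; case: m => [n|[|n]] //; first by rewrite /= afusVKg.
have -> : 1 + Negz n.+1 = Negz n by rewrite !NegzE; lia.
by rewrite [apow a (Negz n.+1)]/= afusVKg.
Qed.

Lemma apowD a m n : abelian_anyon a -> apow a (m + n) = afus (apow a m) (apow a n).
Proof.
move=> Ha; have Aa := anyon_abelian Ha.
have Apow p := anyon_abelian (anyon_apow p Ha).
elim/int_ind: m => [|m IHm|m IHm]; first by rewrite add0r /= afus1g.
  have -> : m.+1%:Z + n = 1 + (m%:Z + n) by lia.
  have -> : m.+1%:Z = 1 + m%:Z by lia.
  by rewrite !apowS // IHm afusA.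
apply: (afusI Aa); rewrite afusA // -!apowS //.
have -> : 1 + - m.+1%:Z = - m%:Z by lia.
by rewrite -IHm; congr apow; lia.
Qed.

Lemma anyon_tdot (t : C * C) u : abelian_anyon t.1 -> abelian_anyon t.2 ->
  abelian_anyon (tdot t u).
Proof. by move=> H1 H2; rewrite anyon_afus ?anyon_apow. Qed.

Lemma tdotD (t : C * C) u v : abelian_anyon t.1 -> abelian_anyon t.2 ->
  tdot t (u + v) = afus (tdot t u) (tdot t v).
Proof.
move=> H1 H2; rewrite /tdot !mxE !apowD //.
by apply: anyon_afusACA; rewrite ?anyon_abelian ?anyon_apow.
Qed.

Lemma tdot0 (t : C * C) : tdot t 0 = vac.
Proof. by rewrite /tdot !mxE /= afus1g. Qed.

End AbelianObjects.

(** * Integer matrices built from the rotation *)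

Section Defects.
Set Implicit Arguments.
Unset Strict Implicit.
Unset Printing Implicit Defensive.

Variables (R : realType) (M : nat) (h : lattice_rotation R M) (phi : rat).
Hypothesis M_gt1 : (1 < M)%N.

(** As 1 - h is invertible over the rationals, matrix identities can be checked after multiplication
    by 1 - h, where geometric sums telescope. *)
Lemma subr_rmx_inj (A B : 'M[int]_2) :
  (1 - rmx h) *m A = (1 - rmx h) *m B -> A = B.
Proof.
have intr_mx_inj : injective (map_mx (intr : int -> rat) : 'M_2 -> 'M_2).
  move=> X Y /matrixP XY; apply/matrixP => i j.
  by have := XY i j; rewrite !mxE => /intr_inj.
move=> /(congr1 (map_mx (intr : int -> rat))).
rewrite !map_mxM map_mxB map_mx1 => /(congr1 (mulmx (invmx (1 - rmxQ h)))).
by rewrite !mulKmx ?unitmx_1subr // => /intr_mx_inj.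
Qed.

Lemma rmx_geom j : (1 - rmx h) *m geom_mx h j = 1 - rmx h ^+ j.
Proof.
by rewrite geom_mxE // -[RHS]opprB subrX1 -mulNr opprB.
Qed.

Lemma geom_mxM : geom_mx h M = 0.
Proof.
apply: subr_rmx_inj; rewrite rmx_geom mulmx0 -[X in _ ^+ X]Zp_cast //.
by rewrite lattice_rotation_order subrr.
Qed.

(** After multiplication by 1 - h the left side is M minus 1 + h + ... + h^(M-1), and this last sum
    vanishes by [geom_mxM]. *)
Lemma sum_geom_mx : \sum_(j < M) geom_mx h j = Minv_mx h.
Proof.
apply: subr_rmx_inj; rewrite Minv_mxE // mulmx_sumr.
rewrite (eq_bigr (fun j : 'I_M => 1 - rmx h ^+ j)) => [|j _]; last exact: rmx_geom.
by rewrite sumrB -geom_mxE // geom_mxM subr0 sumr_const card_ord.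
Qed.

Lemma geom_mxS j : geom_mx h j.+1 = 1 + rmx h *m geom_mx h j.
Proof.
rewrite !geom_mxE // big_ord_recl expr0 mulmx_sumr; congr (_ + _).
by apply: eq_bigr => i _; exact: exprS.
Qed.

(** * The M-th power of a defect of angle 2 pi / M *)

Section DefectPowers.
Variable g : sym_group h phi.
Hypothesis ang_g : angle g = 1.

Lemma angle1E : angle g = 1%N :> nat.
Proof. by rewrite ang_g. Qed.

Lemma angle_expg j : angle (g ^+ j)%g = (j %% M)%N :> nat.
Proof.
rewrite -(val_Zp_nat M_gt1); congr nat_of_ord.
elim: j => [//|j IHj]; rewrite expgS mulrS -IHj -ang_g //.
Qed.

Lemma trans_expg j : trans (g ^+ j)%g = geom_mx h j *m trans g.
Proof.
elim: j => [|j IHj]; first by rewrite geom_mxE // big_ord0 mul0mx.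
rewrite expgS geom_mxS mulmxDl mul1mx -mulmxA -IHj.
by have -> : rmx h = rmx h ^+ angle g; first rewrite angle1E expr1.
Qed.

Variable C : gcrossed_data R (sym_group h phi).
Hypotheses (HC : gcrossed_btc C) (Hperm : no_permutation C).
Variables (s : C) (t : C * C).
Hypotheses (Hs : abelian_anyon s) (Ht1 : abelian_anyon t.1)
  (Ht2 : abelian_anyon t.2).
Variable O : sym_group h phi -> C.
Hypotheses (O_abelian : forall k, abelian (O k))
  (O_fus : forall k l,
     afus (O k) (O l) = afus (frac_cocycle s t k l) (O (k * l)%g)).

(** The cocycle is trivial at the identity, so [O 1] is idempotent for fusion, and it can be
    cancelled. *)
Lemma defect1 : O 1%g = vacuum C.
Proof.
have := O_fus 1%g 1%g; rewrite mulg1 /frac_cocycle /= mulmx0 tdot0 // mod0n div0n.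
rewrite /= (afus1g HC) (afus1g HC).
rewrite -{3}[O 1%g](afusg1 HC (O_abelian 1%g)).
by move/(afusI HC (O_abelian 1%g)).
Qed.

Lemma frac_cocycle_expg j : frac_cocycle s t g (g ^+ j)%g =
  afus (apow s ((1 + j %% M - (1 + j %% M) %% M) %/ M)%N)
    (tdot t (geom_mx h j *m trans g)).
Proof.
rewrite /frac_cocycle angle_expg angle1E trans_expg.
by rewrite [geom_mx h 1]geom_mxE // big_ord1 expr0 mul1mx.
Qed.

(** Below M the angles add without a carry, so no factor [s] appears and only the translation parts
    accumulate. *)
Lemma iter_defect n : (n < M)%N ->
  iter n (afus (O g)) (vacuum C) =
  afus (tdot t ((\sum_(j < n) geom_mx h j) *m trans g)) (O (g ^+ n)%g).
Proof.
have Atdot u : abelian (tdot t u) by rewrite anyon_abelian ?anyon_tdot.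
have Atr u := anyon_tdot HC u Ht1 Ht2.
elim: n => [|n IHn] nM.
  by rewrite big_ord0 mul0mx tdot0 // defect1 (afus1g HC).
rewrite iterS (IHn (ltnW nM)) (afusA HC) //.
rewrite -(anyon_commute HC Hperm (Atr _) (O_abelian g)) -(afusA HC) //.
rewrite O_fus frac_cocycle_expg.
rewrite (modn_small (ltnW nM)) (modn_small nM) subnn div0n.
rewrite [apow s _]/= (afus1g HC) (afusA HC) // -(tdotD HC Hperm) //.
by rewrite big_ord_recr mulmxDl -expgS.
Qed.

Lemma apow_defect : (g ^+ M)%g = 1%g ->
  apow (O g) M = afus s (tdot t (Minv_mx h *m trans g)).
Proof.
have Atdot u : abelian (tdot t u) by rewrite anyon_abelian ?anyon_tdot.
have As := anyon_abelian Hs.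
move=> gM; have [n Mn] : exists n, M = n.+1 by exists M.-1; rewrite prednK // ltnW.
have nM : (n < M)%N by rewrite Mn.
(* The type of [h] depends on M, so M is replaced by n + 1 in the exponent alone. *)
have -> : apow (O g) M = apow (O g) n.+1 by apply: congr1 Mn.
rewrite [apow _ _]iterS.
have Atr u := anyon_tdot HC u Ht1 Ht2.
rewrite iter_defect // (afusA HC) //.
rewrite -(anyon_commute HC Hperm (Atr _) (O_abelian g)) -(afusA HC) //.
(* The last fusion brings the angle to M: this is the only carry, and it contributes exactly one
   [s]. *)
rewrite O_fus frac_cocycle_expg (modn_small nM) add1n -Mn modnn subn0.
rewrite divnn ltnW // -expgS -Mn gM defect1.
rewrite [apow s _]/= (afusg1 HC As) (afusg1 HC (abelian_afus HC As (Atdot _))).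
rewrite (afusA HC _ (Atdot _) As) -(anyon_commute HC Hperm Hs (Atdot _)).
rewrite -(afusA HC _ As (Atdot _)).
rewrite -(tdotD HC Hperm) // -mulmxDl.
rewrite -sum_geom_mx; have sumS (K : nat -> 'M[int]_2) k :
    k = n.+1 -> \sum_(j < k) K j = \sum_(j < n) K j + K n.
  by move=> ->; rewrite big_ord_recr.
by rewrite (sumS _ _ Mn).
Qed.
End DefectPowers.
End Defects.

Theorem mainTheorem12
  (R : realType) (M : nat) (hM : M \in [:: 2; 3; 4; 6]%N)
  (h : lattice_rotation R M) (phi : rat)
  (C : gcrossed_data R (sym_group h phi)) (HC : gcrossed_btc C)
  (Hmodular : modular_trivial_sector C) (Hperm : no_permutation C)
  (s tx ty : C)
  (Hs : abelian_anyon s) (Htx : abelian_anyon tx) (Hty : abelian_anyon ty)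
  (O : sym_group h phi -> C)
  (O_gr : forall g : sym_group h phi, grade (O g) = g)
  (O_abelian : forall g : sym_group h phi, abelian (O g))
  (O_fus : forall g1 g2 : sym_group h phi,
     afus (O g1) (O g2)
     = afus (frac_cocycle s (tx, ty) g1 g2) (O (g1 * g2)%g))
  (r r' : 'cV[int]_2) :
  let g1 := SymElt h phi (circle1 R) 0 1 in
  let g2 := SymElt h phi (circle1 R) r' 1 in
  let g3 := SymElt h phi (circle1 R) r 1 in
  let g4 := SymElt h phi (circle1 R) (r + r') 1 in
  let d1 := O g1 in let d2 := O g2 in let d3 := O g3 in let d4 := O g4 in
  (g1 ^+ M)%g = 1%g -> (g2 ^+ M)%g = 1%g ->
  (g3 ^+ M)%g = 1%g -> (g4 ^+ M)%g = 1%g ->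
  [/\ apow d1 M = s,
      apow d2 M = afus s (tdot (tx, ty) (Minv_mx h *m r')),
      apow d3 M = afus s (tdot (tx, ty) (Minv_mx h *m r)),
      apow d4 M = afus s (tdot (tx, ty) (Minv_mx h *m (r + r')))
    & (Iinv M d4 * Iinv M d1 / (Iinv M d2 * Iinv M d3)) ^+ M
      = double_braid (tdot (tx, ty) (Minv_mx h *m r))
                     (tdot (tx, ty) (Minv_mx h *m r'))].
Proof.
move=> g1 g2 g3 g4 d1 d2 d3 d4 g1M g2M g3M g4M.
have M_gt1 : (1 < M)%N by move: hM; rewrite !inE => /or4P[] /eqP ->.
have dM k : angle k = 1 -> (k ^+ M)%g = 1%g ->
    apow (O k) M = afus s (tdot (tx, ty) (Minv_mx h *m trans k)).
  by move=> k1; apply: (apow_defect M_gt1 k1 HC Hperm Hs (t := (tx, ty)) Htx Hty).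
have E1 : apow d1 M = s.
  by rewrite dM // mulmx0 tdot0 // afusg1 // anyon_abelian.
have [E2 E3 E4] : [/\ apow d2 M = afus s (tdot (tx, ty) (Minv_mx h *m r')),
    apow d3 M = afus s (tdot (tx, ty) (Minv_mx h *m r)) &
    apow d4 M = afus s (tdot (tx, ty) (Minv_mx h *m (r + r')))].
  by split; apply: dM.
split=> //.
have IM (k : sym_group h phi) :
    (k ^+ M)%g = 1%g -> Iinv M (O k) ^+ M = twist (apow (O k) M).
  by move=> kM; rewrite -twist_iter_order // O_gr.
rewrite expr_div_n (exprMn _ (Iinv M d4)) (exprMn _ (Iinv M d2)) (IM g1) //
  (IM g2) // (IM g3) // (IM g4) // E1 E2 E3 E4.
have At u := anyon_tdot HC (t := (tx, ty)) u Htx Hty.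
(* Linearity splits the anyon of r + r' into x x y, with x coming from r and y from r', which
   exposes the second difference at [s]. *)
rewrite mulmxDr (tdotD HC Hperm (t := (tx, ty)) _ _ Htx Hty).
exact: (twist_second_difference HC Hperm Hs (At _) (At _)).
Qed.
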